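(* Assume that the matrices $W\in\mathbb{R}^{n\times n}$ and $T\in\mathbb{R}^{n\times n}$ are symmetric positive definite. For $\alpha>0$ let $$\mathcal{G}_{\alpha}=(W+\alpha T)^{-1}(T-\alpha W)(\alpha W+T)^{-1}(W-\alpha T).$$ Then for every $\alpha>0$ one has $\rho(\mathcal{G}_{\alpha})<1$. That is, the TSCSP iteration method for the linear system $(W+iT)z=b$ is convergent for every $\alpha>0$.
   Context: Here $i=\sqrt{-1}$, $b\in\mathbb{C}^n$, and $\rho(\cdot)$ denotes the spectral radius. For $\alpha>0$, the TSCSP (two-step scale-splitting) iteration method for solving $(W+iT)z=b$ is: given an initial guess $z^{(0)}\in\mathbb{C}^n$, for $k=0,1,2,\ldots$ compute $z^{(k+1/2)}$ and $z^{(k+1)}$ from $$(\alpha W+T)z^{(k+\frac12)}=i(W-\alpha T)z^{(k)}+(\alpha-i)b,$$ $$(W+\alpha T)z^{(k+1)}=i(\alpha W-T)z^{(k+\frac12)}+(1-\alpha i)b.$$ Eliminating $z^{(k+1/2)}$ gives the stationary iteration $z^{(k+1)}=\mathcal{G}_{\alpha}z^{(k)}+c_{\alpha}$ with iteration matrix $\mathcal{G}_\alpha$ as in the claim and $c_{\alpha}=2\alpha(W+\alpha T)^{-1}(W-iT)(\alpha W+T)^{-1}b$. The method is called convergent if, for every initial guess $z^{(0)}$, the sequence $z^{(k)}$ converges to the unique solution of $(W+iT)z=b$ (for a stationary iteration of this kind, this is the meaning of $\rho(\mathcal{G}_\alpha)<1$). *)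

(* Defs.v *)
From mathcomp Require Import all_boot all_order all_algebra.
From mathcomp Require Import complex.
From mathcomp Require Import all_classical all_reals all_analysis.

Set Implicit Arguments.
Unset Strict Implicit.
Unset Printing Implicit Defensive.

Import Order.TTheory GRing.Theory Num.Theory.
Import numFieldNormedType.Exports.
Local Open Scope classical_set_scope.
Local Open Scope ring_scope.

Definition posdefmx (R : realType) (n : nat) (A : 'M[R]_n) : Prop :=
  A \is symmetricmx /\
  forall x : 'cV[R]_n, x != 0 -> 0 < (x^T *m A *m x) 0 0.

(* [eigenvalue] uses row eigenvectors, [v *m A = a *: v]: for a square matrix
   this gives the same eigenvalues as column eigenvectors. The set has at most
   n elements; it is empty when n = 0, and then the value is [sup set0 = 0]. *)
Definition spectral_radius (R : realType) (n : nat) (A : 'M[R[i]]_n) : R :=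
  sup [set ComplexField.Normc.normc a | a in [set a : R[i] | eigenvalue A a]].

Definition complexmx (R : realType) (m n : nat) (A : 'M[R]_(m, n)) :
    'M[R[i]]_(m, n) :=
  map_mx (real_complex R) A.

Definition tscsp_mx (R : realType) (n : nat) (W T : 'M[R]_n) (alpha : R) :
    'M[R]_n :=
  invmx (W + alpha *: T) *m (T - alpha *: W)
    *m invmx (alpha *: W + T) *m (W - alpha *: T).

Definition tscsp_system (R : realType) (n : nat) (W T : 'M[R]_n) : 'M[R[i]]_n :=
  complexmx W + ('i)%C *: complexmx T.

(* [z k] is the k-th iterate and [zh k] the half-step iterate of index k + 1/2.
   The two steps are linear systems to be solved, so a run of the method is
   described by the equations it satisfies. *)
Definition tscsp_run (R : realType) (n : nat) (W T : 'M[R]_n) (b : 'cV[R[i]]_n)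
    (alpha : R) (z zh : nat -> 'cV[R[i]]_n) : Prop :=
  forall k : nat,
    complexmx (alpha *: W + T) *m zh k =
      ('i)%C *: (complexmx (W - alpha *: T) *m z k)
        + ((alpha%:C)%C - ('i)%C) *: b /\
    complexmx (W + alpha *: T) *m z k.+1 =
      ('i)%C *: (complexmx (alpha *: W - T) *m zh k)
        + (1 - (alpha%:C)%C * ('i)%C) *: b.

(* From every initial guess the method can be run, and every run converges to
   the unique solution. [R[i]^o] is [R[i]] with the topology of its modulus. *)
Definition tscsp_convergent (R : realType) (n : nat) (W T : 'M[R]_n)
    (b : 'cV[R[i]]_n) (alpha : R) : Prop :=
  exists2 zsol : 'cV[R[i]]_n,
    unique (fun z : 'cV[R[i]]_n => tscsp_system W T *m z = b) zsol &
    forall z0 : 'cV[R[i]]_n,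
      (exists z zh : nat -> 'cV[R[i]]_n,
          z 0%N = z0 /\ tscsp_run W T b alpha z zh) /\
      (forall z zh : nat -> 'cV[R[i]]_n,
          z 0%N = z0 -> tscsp_run W T b alpha z zh ->
          (z : nat -> 'cV[R[i]^o]_n) @ \oo --> (zsol : 'cV[R[i]^o]_n)).

(* Main.v *)
Require Import Defs.
From mathcomp Require Import all_boot all_order all_algebra.
From mathcomp Require Import complex.
From mathcomp Require Import all_classical all_reals all_analysis.
From mathcomp Require Import ring lra.

Set Implicit Arguments.
Unset Strict Implicit.
Unset Printing Implicit Defensive.

Import Order.TTheory GRing.Theory Num.Theory.
Import numFieldNormedType.Exports.
Local Open Scope classical_set_scope.
Local Open Scope ring_scope.

(** Each half-step carries one factor [i], so that a full step multiplies the
    error by the real matrix [G = tscsp_mx W T alpha]. Everything follows once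
    the orbits of [G] are known to tend to zero, for which an energy argument
    suffices. Write [P = W + alpha T] and measure a vector
    [e] by [E e = (P e)^T W^-1 (P e)]. In the inner product of [W^-1], the
    vectors [W y] and [T y] have product [y^T T y], so the polarization identity
    makes [(a W - b T) y] shorter than [(a W + b T) y] for positive [a] and [b],
    their squared lengths differing by [4 a b y^T T y] ([qform_inv_split]).
    Both factors [(W - alpha T) P^-1] and [(T - alpha W) (alpha W + T)^-1] of
    the conjugate [P G P^-1] therefore shorten vectors, and the loss in the
    factor that acts first gives [E (G e) <= E e - 4 alpha e^T T e]
    ([energy_tscsp]). As [E] stays
    nonnegative, the losses [e_k^T T e_k] along an orbit tend to zero, and they
    control every coordinate of [e_k] because [T] is positive definite
    ([coord_qform_bound]).

    Complex orbits of [G] are handled through their real and imaginary parts.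
    An eigenvector for [a] gives the orbit [a ^+ k *: v], whose convergence to
    zero forces [|a| < 1]; the spectrum is finite, so its radius is smaller
    than 1. For the method itself, [W + i T] is invertible
    ([tscsp_system_unit]), its solution is a fixed point of both half-steps
    ([tscsp_fixpoint]), and the errors of a run form an orbit of [G]
    ([tscsp_run_error]). *)

(** * Bilinear forms and positive definite matrices *)

Definition bform (R : pzRingType) (n : nat) (A : 'M[R]_n)
    (x y : 'cV[R]_n) : R :=
  (x^T *m A *m y) 0 0.

Definition qform (R : pzRingType) (n : nat) (A : 'M[R]_n) (x : 'cV[R]_n) : R :=
  bform A x x.

Lemma inj_unitmx (F : fieldType) (n : nat) (A : 'M[F]_n) :
  (forall x : 'cV[F]_n, A *m x = 0 -> x = 0) -> A \in unitmx.
Proof.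
move=> injA; rewrite -unitmx_tr -row_free_unit; apply: inj_row_free => v vA.
apply: trmx_inj; rewrite trmx0; apply: injA.
by rewrite -[A]trmxK -trmx_mul vA trmx0.
Qed.

Section PositiveDefinite.
Variables (R : realType) (n : nat).
Implicit Types (A B W T : 'M[R]_n) (x y z : 'cV[R]_n).

Lemma posdefmx_tr A : posdefmx A -> A^T = A.
Proof.
move=> [/is_hermitianmxP + _]; rewrite expr0 scale1r.
by rewrite (map_mx_id (fun=> erefl)) => <-.
Qed.

Lemma posdefmx_gt0 A x : posdefmx A -> x != 0 -> 0 < qform A x.
Proof. by move=> [_]; exact. Qed.

Lemma posdefmx_ge0 A x : posdefmx A -> 0 <= qform A x.
Proof.
move=> pA; have [->|x0] := eqVneq x 0; last exact/ltW/posdefmx_gt0.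
by rewrite /qform /bform mulmx0 mxE.
Qed.

Lemma posdefmxP A :
  A^T = A -> (forall x, x != 0 -> 0 < qform A x) -> posdefmx A.
Proof.
move=> symA posA; split; last exact: posA.
by apply/is_hermitianmxP; rewrite expr0 scale1r (map_mx_id (fun=> erefl)).
Qed.

Lemma qformD A B x : qform (A + B) x = qform A x + qform B x.
Proof. by rewrite /qform /bform mulmxDr mulmxDl mxE. Qed.

Lemma qformZ a A x : qform (a *: A) x = a * qform A x.
Proof. by rewrite /qform /bform -scalemxAr -scalemxAl mxE. Qed.

Lemma posdefmxD A B : posdefmx A -> posdefmx B -> posdefmx (A + B).
Proof.
move=> pA pB; apply: posdefmxP; first by rewrite linearD /= !posdefmx_tr.
by move=> x x0; rewrite qformD addr_gt0// posdefmx_gt0.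
Qed.

Lemma posdefmxZ a A : 0 < a -> posdefmx A -> posdefmx (a *: A).
Proof.
move=> a0 pA; apply: posdefmxP; first by rewrite linearZ /= posdefmx_tr.
by move=> x x0; rewrite qformZ mulr_gt0// posdefmx_gt0.
Qed.

Lemma posdefmx_unit A : posdefmx A -> A \in unitmx.
Proof.
move=> pA; apply: inj_unitmx => x Ax; apply/eqP/negPn/negP => x0.
by have := posdefmx_gt0 pA x0; rewrite /qform /bform -mulmxA Ax mulmx0 mxE ltxx.
Qed.

Lemma posdefmx_inv A : posdefmx A -> posdefmx (invmx A).
Proof.
move=> pA; have uA := posdefmx_unit pA.
apply: posdefmxP => [|x x0]; first by rewrite trmx_inv posdefmx_tr.
have -> : qform (invmx A) x = qform A (invmx A *m x).
  rewrite /qform /bform trmx_mul trmx_inv posdefmx_tr// -!mulmxA.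
  by rewrite (mulmxA A) mulmxV// mul1mx.
apply: posdefmx_gt0 => //; apply: contra_neq x0 => x0.
by rewrite -[x](mulKVmx uA) x0 mulmx0.
Qed.

Lemma bform_sym A x y : A^T = A -> bform A x y = bform A y x.
Proof.
move=> symA; rewrite /bform; have -> : y^T *m A *m x = (x^T *m A *m y)^T.
  by rewrite trmx_mul trmx_mul trmxK symA mulmxA.
by rewrite [RHS]mxE.
Qed.

Lemma bformDl A x y z : bform A (x + y) z = bform A x z + bform A y z.
Proof. by rewrite /bform [(x + y)^T]linearD/= !mulmxDl mxE. Qed.

Lemma bformDr A x y z : bform A x (y + z) = bform A x y + bform A x z.
Proof. by rewrite /bform mulmxDr mxE. Qed.

Lemma qform_add A x y : A^T = A ->
  qform A (x + y) = qform A x + 2 * bform A x y + qform A y.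
Proof.
move=> symA; rewrite /qform bformDl !bformDr (bform_sym y x)//.
by rewrite mulr_natl mulr2n !addrA.
Qed.

Lemma bformZr a A x y : bform A x (a *: y) = a * bform A x y.
Proof. by rewrite /bform -scalemxAr mxE. Qed.

Lemma bformZl a A x y : bform A (a *: x) y = a * bform A x y.
Proof. by rewrite /bform linearZ/= -!scalemxAl mxE. Qed.

Lemma qform_sub A x y : A^T = A ->
  qform A (x - y) = qform A (x + y) - 4 * bform A x y.
Proof.
move=> symA; rewrite !qform_add// -scaleN1r /qform.
by rewrite !bformZr bformZl; ring.
Qed.

(** The cross term of the polarization identity is
    [(W y)^T W^-1 (T y) = y^T T y]; the weight [W^-1] is the one that makes it a
    positive quantity in spite of [W] and [T] not commuting. *)
Lemma qform_inv_split W T a b y : posdefmx W ->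
  qform (invmx W) ((a *: W - b *: T) *m y) =
  qform (invmx W) ((a *: W + b *: T) *m y) - 4 * (a * b) * qform T y.
Proof.
move=> pW; rewrite mulmxBl mulmxDl qform_sub; last first.
  by rewrite posdefmx_tr//; exact: posdefmx_inv.
rewrite -!scalemxAl bformZl bformZr.
have -> : bform (invmx W) (W *m y) (T *m y) = qform T y.
  rewrite /qform /bform trmx_mul posdefmx_tr// !mulmxA mulmxK//.
  exact: posdefmx_unit.
by ring.
Qed.

(** The [j]-th coordinate of [x] is the [A]-product of [x] with
    [u = A^-1 e_j], so this is the Cauchy-Schwarz inequality for the form [A],
    with the constant [u^T A u]. *)
Lemma coord_qform_bound A (j : 'I_n) : posdefmx A ->
  exists c : R, forall x, (x j 0) ^+ 2 <= c * qform A x.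
Proof.
move=> pA; pose u : 'cV[R]_n := invmx A *m delta_mx j 0.
have symA := posdefmx_tr pA.
have Au : A *m u = delta_mx j 0 by rewrite mulKVmx//; exact: posdefmx_unit.
have bAu x : bform A x u = x j 0.
  by rewrite /bform -mulmxA Au -colE !mxE.
have u0 : u != 0.
  apply: contra_eq_neq Au => ->; rewrite mulmx0; apply/eqP => /matrixP/(_ j 0).
  by rewrite !mxE !eqxx => /esym/eqP; rewrite oner_eq0.
have c0 : 0 < qform A u by exact: posdefmx_gt0.
exists (qform A u) => x.
set c := qform A u in c0 *.
(* The value of the form at x minus its A-projection on u is nonnegative. *)
have := posdefmx_ge0 (x + (- (x j 0 / c)) *: u) pA.
rewrite qform_add// bformZr bAu.
have -> : qform A ((- (x j 0 / c)) *: u) = (x j 0 / c) ^+ 2 * c.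
  by rewrite /qform bformZr bformZl -/(qform A u) -/c; ring.
have -> : qform A x + 2 * (- (x j 0 / c) * x j 0) + (x j 0 / c) ^+ 2 * c
   = qform A x - (x j 0) ^+ 2 / c by field; rewrite gt_eqF.
by rewrite subr_ge0 ler_pdivrMr// mulrC.
Qed.

End PositiveDefinite.

(** * Descent sequences *)

Section Descent.
Variable R : realType.

(** A nonincreasing [E] bounded below converges, so its successive drops, which
    dominate [c * t k], tend to zero. *)
Lemma descent_cvg0 (E t : nat -> R) (c : R) : 0 < c ->
  (forall k, 0 <= E k) -> (forall k, 0 <= t k) ->
  (forall k, E k.+1 <= E k - c * t k) -> t k @[k --> \oo] --> 0.
Proof.
move=> c0 E0 t0 Et.
have cvE : cvgn E.
  apply: nonincreasing_is_cvgn; last first.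
    by exists 0 => _ [k _ <-].
  apply/nonincreasing_seqP => k; apply: le_trans (Et k) _.
  by rewrite gerBl mulr_ge0// ltW.
have cvd : (E k - E k.+1) / c @[k --> \oo] --> (limn E - limn E) / c.
  by apply: cvgMl; apply: cvgB => //; rewrite (cvg_shiftS E).
rewrite subrr mul0r in cvd.
apply: squeeze_cvgr cvd; last exact: cvg_cst.
apply: nearW => k; rewrite t0/= ler_pdivlMr// mulrC.
by have := Et k; lra.
Qed.

Lemma cvg0_sqr_le (a t : nat -> R) (c : R) :
  (forall k, a k ^+ 2 <= c * t k) -> t k @[k --> \oo] --> 0 ->
  a k @[k --> \oo] --> 0.
Proof.
move=> at0 t0.
have cvs : a k ^+ 2 @[k --> \oo] --> 0.
  apply: (@squeeze_cvgr _ _ _ _ (fun=> 0) (fun k => c * t k)).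
  - by apply: nearW => k; rewrite sqr_ge0 at0.
  - exact: cvg_cst.
  - by rewrite -(mulr0 c); apply: cvgMr.
apply/cvgr0Pnorm_lt => e e0.
have e20 : 0 < e ^+ 2 by rewrite exprn_gt0.
move/cvgr0Pnorm_lt : cvs => /(_ _ e20); apply: filterS => k /=.
by rewrite normrX ltr_pXn2r// nnegrE ltW.
Qed.

End Descent.

(** * Real orbits of the iteration matrix *)

Section RealIterates.
Variables (R : realType) (n : nat) (W T : 'M[R]_n) (alpha : R).
Hypotheses (posW : posdefmx W) (posT : posdefmx T) (alpha0 : 0 < alpha).

Lemma tscsp_full_unit : W + alpha *: T \in unitmx.
Proof. by apply: posdefmx_unit; apply: posdefmxD => //; exact: posdefmxZ. Qed.

Lemma tscsp_half_unit : alpha *: W + T \in unitmx.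
Proof. by apply: posdefmx_unit; apply: posdefmxD => //; exact: posdefmxZ. Qed.

(** The factor [W + alpha T] passes from the iteration matrix to its conjugate
    by [W + alpha T], a product of two contractions for the norm of [W^-1]. *)
Definition energy (x : 'cV[R]_n) : R :=
  qform (invmx W) ((W + alpha *: T) *m x).

(** With [h] the real counterpart of the half-step, the energy of the image of
    [x] is the squared length of [(alpha W - T) h]. It is at most that of
    [(alpha W + T) h = (W - alpha T) x], which in turn falls short of the energy
    of [x] by [4 alpha x^T T x]. *)
Lemma energy_tscsp x :
  energy (tscsp_mx W T alpha *m x) <= energy x - 4 * alpha * qform T x.
Proof.
pose h := invmx (alpha *: W + T) *m ((W - alpha *: T) *m x).
have -> : energy (tscsp_mx W T alpha *m x) =
    qform (invmx W) ((alpha *: W - 1 *: T) *m h).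
  rewrite /energy /tscsp_mx -!mulmxA mulKVmx ?tscsp_full_unit//.
  rewrite -/h scale1r -(opprB _ T) mulNmx /qform -scaleN1r bformZl bformZr.
  by rewrite mulrA mulrNN !mul1r.
rewrite qform_inv_split// scale1r mulKVmx ?tscsp_half_unit//.
rewrite -[X in X - _ *: T]scale1r qform_inv_split// scale1r.
rewrite -/(energy x) mul1r mulr1 gerBl.
by rewrite mulr_ge0 ?posdefmx_ge0// mulr_ge0// ltW.
Qed.

Lemma tscsp_iterates_cvg0 (x : nat -> 'cV[R]_n) (j : 'I_n) :
  (forall k, x k.+1 = tscsp_mx W T alpha *m x k) ->
  x k j 0 @[k --> \oo] --> 0.
Proof.
move=> xS; have [c cP] := coord_qform_bound j posT.
apply: (cvg0_sqr_le (fun k => cP (x k))).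
apply: (@descent_cvg0 _ (energy \o x) _ (4 * alpha)) => [|k|k|k] /=.
- by rewrite mulr_gt0.
- by apply: posdefmx_ge0; exact: posdefmx_inv.
- exact: posdefmx_ge0.
- by rewrite xS energy_tscsp.
Qed.

End RealIterates.

(** * Complex orbits and the spectral radius *)

Section Complexification.
Variable R : realType.
Local Notation Re := (@complex.Re R).
Local Notation Im := (@complex.Im R).
Local Notation normc := (@ComplexField.Normc.normc R).

Lemma map_Re_mulmx m n p (A : 'M[R]_(m, n)) (Z : 'M[R[i]]_(n, p)) :
  map_mx Re (complexmx A *m Z) = A *m map_mx Re Z.
Proof.
apply/matrixP => i j; rewrite !mxE.
rewrite (big_morph Re (id1 := 0) (op1 := +%R))//; last first.
  by move=> [? ?] [? ?].
apply: eq_bigr => k _; rewrite !mxE.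
by case: (Z k j) => a b /=; rewrite mul0r subr0.
Qed.

Lemma map_Im_mulmx m n p (A : 'M[R]_(m, n)) (Z : 'M[R[i]]_(n, p)) :
  map_mx Im (complexmx A *m Z) = A *m map_mx Im Z.
Proof.
apply/matrixP => i j; rewrite !mxE.
rewrite (big_morph Im (id1 := 0) (op1 := +%R))//; last first.
  by move=> [? ?] [? ?].
apply: eq_bigr => k _; rewrite !mxE.
by case: (Z k j) => a b /=; rewrite mul0r addr0.
Qed.

Lemma normc_le_ReIm (z : R[i]) : normc z <= `|Re z| + `|Im z|.
Proof.
case: z => a b /=; rewrite -[leRHS]ger0_norm ?addr_ge0// -sqrtr_sqr.
rewrite ler_wsqrtr// sqrrD !real_normK ?num_real// lerD2r lerDl.
by rewrite mulrn_wge0// mulr_ge0.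
Qed.

Lemma normc_ge0 (z : R[i]) : 0 <= normc z.
Proof. by case: z => a b /=; exact: sqrtr_ge0. Qed.

End Complexification.

Section Spectrum.
Variables (R : realType) (n : nat).
Local Notation normc := (@ComplexField.Normc.normc R).

Lemma normcX (a : R[i]) k : normc (a ^+ k) = normc a ^+ k.
Proof.
elim: k => [|k IH]; first by rewrite !expr0 ComplexField.Normc.normc1.
by rewrite !exprS ComplexField.Normc.normcM IH.
Qed.

(** The finiteness of the spectrum is what turns the strict bounds into a strict
    bound for the supremum; over an algebraically closed field the eigenvalues
    are the entries of the list that splits the characteristic polynomial. *)
Lemma spectral_radius_lt1 (A : 'M[R[i]]_n) :
  (forall a, eigenvalue A a -> normc a < 1) -> spectral_radius A < 1.
Proof.
move=> A1; rewrite /spectral_radius; set S := (X in sup X).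
(* In dimension 0 the spectrum is empty and its supremum is 0. *)
have [S0|/set0P S0] := eqVneq S set0; first by rewrite S0 sup0 ltr01.
have [r rE] := closed_field_poly_normal (char_poly A).
have eigE a : eigenvalue A a = (a \in r).
  rewrite eigenvalue_root_char rE (monicP (char_poly_monic A)) scale1r.
  exact: root_prod_XsubC.
pose c := \big[Num.max/0]_(a <- r) normc a.
have c1 : c < 1.
  rewrite /c big_seq; apply: bigmax_lt => // a ar.
  by apply: A1; rewrite eigE.
apply: le_lt_trans c1; apply: ge_sup => // _ [a /= ea <-].
by rewrite eigE in ea; exact: (le_bigmax_seq 0 a predT normc ea isT).
Qed.

End Spectrum.

Section ComplexIterates.
Variables (R : realType) (n : nat) (W T : 'M[R]_n) (alpha : R).
Hypotheses (posW : posdefmx W) (posT : posdefmx T) (alpha0 : 0 < alpha).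
Local Notation Re := (@complex.Re R).
Local Notation Im := (@complex.Im R).
Local Notation normc := (@ComplexField.Normc.normc R).

Lemma tscsp_complex_iterates_cvg0 (z : nat -> 'cV[R[i]]_n) (j : 'I_n) :
  (forall k, z k.+1 = complexmx (tscsp_mx W T alpha) *m z k) ->
  normc (z k j 0) @[k --> \oo] --> 0.
Proof.
move=> zS.
have cRe : map_mx Re (z k) j 0 @[k --> \oo] --> 0.
  apply: (tscsp_iterates_cvg0 posW posT alpha0 (x := fun k => map_mx Re (z k))).
  by move=> k; rewrite zS map_Re_mulmx.
have cIm : map_mx Im (z k) j 0 @[k --> \oo] --> 0.
  apply: (tscsp_iterates_cvg0 posW posT alpha0 (x := fun k => map_mx Im (z k))).
  by move=> k; rewrite zS map_Im_mulmx.
apply: (@squeeze_cvgr _ _ _ _ (fun=> 0)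
  (fun k => `|map_mx Re (z k) j 0| + `|map_mx Im (z k) j 0|)).
- by apply: nearW => k; rewrite normc_ge0 !mxE normc_le_ReIm.
- exact: cvg_cst.
- rewrite -[X in _ --> X]addr0 -{1 2}(normr0 R).
  by apply: cvgD; apply: cvg_norm.
Qed.

(** If [A u = a u], then [a ^+ k *: u] is an orbit and tends to zero, while
    [|a| >= 1] would keep its nonzero coordinates away from zero. *)
Lemma tscsp_eigenvalue_lt1 a :
  eigenvalue (complexmx (tscsp_mx W T alpha)) a -> normc a < 1.
Proof.
set A := complexmx _ => eA.
(* Eigenvalues are defined by row vectors, orbits by column vectors: pass
   through the determinant. *)
have : \det (a%:M - A)^T == 0.
  rewrite det_tr; move/eigenvalueP : eA => [u uA u0].
  apply/det0P; exists u => //.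
  by rewrite mulmxBr uA mul_mx_scalar subrr.
move=> /det0P[u u0 uA].
have {}uA : A *m u^T = a *: u^T.
  move/(congr1 trmx) : uA; rewrite trmx0 trmx_mul trmxK mulmxBl mul_scalar_mx.
  by move/eqP; rewrite subr_eq0 => /eqP <-.
have [j uj] : exists j, u 0 j != 0.
  by move/rV0Pn : u0.
have := @tscsp_complex_iterates_cvg0 (fun k => a ^+ k *: u^T) j.
move=> /(_ _)/cvgr0Pnorm_lt cv; rewrite ltNge; apply/negP => a1.
have uj0 : 0 < normc (u 0 j).
  rewrite lt_neqAle normc_ge0 andbT eq_sym.
  by apply: contra_neq uj => /ComplexField.Normc.eq0_normc.
have [|N _ /(_ N (leqnn _))] := cv _ _ uj0.
  by move=> k; rewrite -/A -scalemxAr uA scalerA exprSr.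
rewrite /= !mxE ComplexField.Normc.normcM normcX.
rewrite ger0_norm ?mulr_ge0 ?exprn_ge0 ?normc_ge0//.
by apply/negP; rewrite -leNgt ler_peMl ?normc_ge0// exprn_ege1.
Qed.

(** For [z = x + i y] in the kernel, [W x = T y] and [W y = - T x]. Pairing the
    first equation with [x] and the second with [y] cancels the [T] terms and
    leaves [x^T W x + y^T W y = 0]. *)
Lemma tscsp_system_unit : tscsp_system W T \in unitmx.
Proof.
apply: inj_unitmx => z Sz.
pose x := map_mx Re z; pose y := map_mx Im z.
have splitS M N : map_mx Re (complexmx M *m z + 'i%C *: (complexmx N *m z)) =
    M *m x - N *m y.
  rewrite -!map_Re_mulmx -map_Im_mulmx; apply/matrixP => k l; rewrite !mxE.
  by case: (\sum_j _) => a b; case: (\sum_j _) => c d /=; ring.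
have splitS' M N : map_mx Im (complexmx M *m z + 'i%C *: (complexmx N *m z)) =
    M *m y + N *m x.
  rewrite -!map_Im_mulmx -map_Re_mulmx; apply/matrixP => k l; rewrite !mxE.
  by case: (\sum_j _) => a b; case: (\sum_j _) => c d /=; ring.
rewrite /tscsp_system mulmxDl -scalemxAl in Sz.
have re0 : W *m x - T *m y = 0.
  by rewrite -splitS Sz; apply/matrixP => ? ?; rewrite !mxE.
have im0 : W *m y + T *m x = 0.
  by rewrite -splitS' Sz; apply/matrixP => ? ?; rewrite !mxE.
have W0 : qform W x + qform W y = 0.
  have rex : bform W x x - bform T x y = 0.
    have <- : (x^T *m (W *m x - T *m y)) 0 0 = bform W x x - bform T x y.
      by rewrite mulmxBr !mulmxA [LHS]mxE; congr (_ + _); rewrite mxE.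
    by rewrite re0 mulmx0 mxE.
  have imy : bform W y y + bform T y x = 0.
    have <- : (y^T *m (W *m y + T *m x)) 0 0 = bform W y y + bform T y x.
      by rewrite mulmxDr !mulmxA mxE.
    by rewrite im0 mulmx0 mxE.
  move: rex; rewrite (bform_sym x y (posdefmx_tr posT)) /qform; lra.
have x0 : x = 0.
  apply/eqP/negPn/negP => /(posdefmx_gt0 posW) Wx.
  by have := posdefmx_ge0 y posW; lra.
have y0 : y = 0.
  apply/eqP/negPn/negP => /(posdefmx_gt0 posW) Wy.
  by have := posdefmx_ge0 x posW; lra.
apply/matrixP => k l; move/matrixP/(_ k l) : x0; move/matrixP/(_ k l) : y0.
by rewrite !mxE; case: (z k l) => a b /= -> ->.
Qed.

End ComplexIterates.

(** * Runs of the method *)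

(** Convergence of column vectors is coordinatewise; stating the hypothesis with
    the real-valued modulus lets the estimates above be used directly. *)
Lemma cvg_colmx (R : realType) (n : nat) (z : nat -> 'cV[R[i]]_n)
    (l : 'cV[R[i]]_n) :
  (forall j, ComplexField.Normc.normc ((z k - l) j 0) @[k --> \oo]
     --> (0 : R)) ->
  (z : nat -> 'cV[R[i]^o]_n) @ \oo --> (l : 'cV[R[i]^o]_n).
Proof.
move=> cv P [Q Ql QP].
suff : \forall k \near \oo, forall j, Q j 0 (z k j 0).
  by apply: filterS => k Qz; apply: QP => i j; rewrite (ord1 j).
apply: filter_forall => j.
suff : (fun k => z k j 0 : R[i]^o) @ \oo --> (l j 0 : R[i]^o).
  by apply; exact: Ql.
apply/(@cvgrPdist_lt _ R[i]^o) => e e0.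
have eE : e = (complex.Re e)%:C%C by rewrite RRe_real// gtr0_real.
rewrite eE ltcR in e0.
move/cvgr0Pnorm_lt : (cv j) => /(_ _ e0); apply: filterS => k.
rewrite ger0_norm ?normc_ge0// eE -ltcR distrC !mxE; apply: le_lt_trans.
by rewrite normc_def; case: (_ - _).
Qed.

Section Run.
Variables (R : realType) (n : nat) (W T : 'M[R]_n) (alpha : R).
Hypotheses (posW : posdefmx W) (posT : posdefmx T) (alpha0 : 0 < alpha).

Lemma complexmxB (A B : 'M[R]_n) :
  complexmx (A - B) = complexmx A - complexmx B.
Proof. exact: map_mxB. Qed.

Lemma complexmxD (A B : 'M[R]_n) :
  complexmx (A + B) = complexmx A + complexmx B.
Proof. exact: map_mxD. Qed.

Lemma complexmxZ a (A : 'M[R]_n) : complexmx (a *: A) = (a%:C)%C *: complexmx A.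
Proof. exact: map_mxZ. Qed.

Lemma complexmx_unit (A : 'M[R]_n) : (complexmx A \in unitmx) = (A \in unitmx).
Proof. exact: map_unitmx. Qed.

(** The right-hand sides are consistent because
    [i (W - alpha T) + (alpha - i) (W + i T) = alpha W + T] and
    [i (alpha W - T) + (1 - alpha i) (W + i T) = W + alpha T]. *)
Lemma tscsp_fixpoint (z : 'cV[R[i]]_n) :
  complexmx (alpha *: W + T) *m z =
    ('i)%C *: (complexmx (W - alpha *: T) *m z)
      + ((alpha%:C)%C - ('i)%C) *: (tscsp_system W T *m z) /\
  complexmx (W + alpha *: T) *m z =
    ('i)%C *: (complexmx (alpha *: W - T) *m z)
      + (1 - (alpha%:C)%C * ('i)%C) *: (tscsp_system W T *m z).
Proof.
rewrite /tscsp_system !complexmxB !complexmxD !complexmxZ.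
rewrite !(mulmxDl, mulNmx) -!scalemxAl.
move: (complexmx W *m z) (complexmx T *m z) => w t.
have ii : ('i%C : R[i]) * 'i%C = -1 by rewrite -expr2 sqr_i.
move: (alpha%:C)%C ('i%C : R[i]) ii => a i ii.
split; apply/matrixP => k l; rewrite !mxE.
  have -> : i * (w k l - a * t k l) + (a - i) * (w k l + i * t k l) =
    a * w k l - (i * i) * t k l by ring.
  by rewrite ii; ring.
have -> : i * (a * w k l - t k l) + (1 - a * i) * (w k l + i * t k l) =
  w k l - (i * i) * a * t k l by ring.
by rewrite ii; ring.
Qed.

(** The two factors [i] multiply to [-1], which turns [alpha W - T] into
    [T - alpha W]: this is why the iteration matrix is real. *)
Lemma tscsp_elimination (e h e' : 'cV[R[i]]_n) :
  complexmx (alpha *: W + T) *m h =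
    ('i)%C *: (complexmx (W - alpha *: T) *m e) ->
  complexmx (W + alpha *: T) *m e' =
    ('i)%C *: (complexmx (alpha *: W - T) *m h) ->
  e' = complexmx (tscsp_mx W T alpha) *m e.
Proof.
move=> eh ee'.
have uP : complexmx (W + alpha *: T) \in unitmx.
  by rewrite complexmx_unit tscsp_full_unit.
have uQ : complexmx (alpha *: W + T) \in unitmx.
  by rewrite complexmx_unit tscsp_half_unit.
rewrite /tscsp_mx /complexmx !map_mxM !map_invmx -/(complexmx _).
rewrite -[LHS](mulKmx uP) ee' -[h](mulKmx uQ) eh -opprB.
rewrite -!/(complexmx _) (_ : complexmx (- _) = - complexmx (T - alpha *: W)).
  by rewrite -!scalemxAr scalerA -expr2 sqr_i scaleN1r mulNmx mulmxN opprK
             !mulmxA.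
exact: map_mxN.
Qed.

Lemma tscsp_run_error (b zsol : 'cV[R[i]]_n) z zh :
  tscsp_system W T *m zsol = b -> tscsp_run W T b alpha z zh ->
  forall k, z k.+1 - zsol = complexmx (tscsp_mx W T alpha) *m (z k - zsol).
Proof.
move=> solE run k; have [f1 f2] := tscsp_fixpoint zsol.
have [r1 r2] := run k; rewrite solE in f1 f2.
apply: (@tscsp_elimination _ (zh k - zsol)).
- by rewrite mulmxBr r1 f1 opprD addrACA subrr addr0 mulmxBr scalerBr.
- by rewrite mulmxBr r2 f2 opprD addrACA subrr addr0 mulmxBr scalerBr.
Qed.

Lemma tscsp_run_exists (b z0 : 'cV[R[i]]_n) :
  exists z zh, z 0%N = z0 /\ tscsp_run W T b alpha z zh.
Proof.
have uP : complexmx (W + alpha *: T) \in unitmx.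
  by rewrite complexmx_unit tscsp_full_unit.
have uQ : complexmx (alpha *: W + T) \in unitmx.
  by rewrite complexmx_unit tscsp_half_unit.
pose half (z : 'cV[R[i]]_n) := invmx (complexmx (alpha *: W + T)) *m
  (('i)%C *: (complexmx (W - alpha *: T) *m z) + ((alpha%:C)%C - ('i)%C) *: b).
pose next z := invmx (complexmx (W + alpha *: T)) *m
  (('i)%C *: (complexmx (alpha *: W - T) *m half z)
    + (1 - (alpha%:C)%C * ('i)%C) *: b).
exists (fun k => iter k next z0), (fun k => half (iter k next z0)).
by split=> // k; rewrite iterS !mulKVmx.
Qed.

End Run.

Theorem theorem1 (R : realType) (n : nat) (W T : 'M[R]_n)
    (b : 'cV[R[i]]_n) (posW : posdefmx W) (posT : posdefmx T) :
  forall alpha : R, 0 < alpha ->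
    spectral_radius (complexmx (tscsp_mx W T alpha)) < 1 /\
    tscsp_convergent W T b alpha.
Proof.
move=> alpha alpha0; split.
  by apply: spectral_radius_lt1 => a; exact: tscsp_eigenvalue_lt1.
have uS : tscsp_system W T \in unitmx by exact: tscsp_system_unit.
exists (invmx (tscsp_system W T) *m b).
  by split=> [|z <-]; rewrite ?mulKVmx ?mulKmx.
move=> z0; split; first exact: tscsp_run_exists.
move=> z zh _ run; apply: cvg_colmx => j.
apply: (tscsp_complex_iterates_cvg0 posW posT alpha0
  (z := fun k => z k - invmx (tscsp_system W T) *m b)).
exact: tscsp_run_error (mulKVmx uS b) run.
Qed.
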